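(* For every integer $n \geq 0$, \[ d_n(x) = \sum_{l=0}^n S_1(n,l)\, b_l(x). \] In particular, $d_n = \sum_{l=0}^n S_1(n,l)\, b_l$.
   Context: All generating functions are formal power series in $t$. The type 2 Bernoulli polynomials $b_n(x)$ are defined by $\frac{t}{e^t-e^{-t}}e^{xt} = \sum_{n\ge0} b_n(x)\frac{t^n}{n!}$, with $b_n=b_n(0)$. The type 2 Daehee polynomials $d_n(x)$ are defined by $\frac{\log(1+t)}{(1+t)-(1+t)^{-1}}(1+t)^x = \sum_{n\ge0} d_n(x)\frac{t^n}{n!}$, with $d_n = d_n(0)$. The (signed) Stirling numbers of the first kind $S_1(n,l)$ are defined by $\frac{1}{l!}(\log(1+t))^l = \sum_{n\ge l} S_1(n,l)\frac{t^n}{n!}$. *)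

(* Defs.v *)
(* Classical axioms enter only through the choice structure on power series,
   their extensionality, and [xget] in [fps_div]. *)
From HB Require Import structures.
From mathcomp Require Import all_boot all_order all_algebra.
From mathcomp Require Import boolp classical_sets.
From mathcomp Require Import ring.

Set Implicit Arguments.
Unset Strict Implicit.
Unset Printing Implicit Defensive.

Import GRing.Theory Num.Theory.
Local Open Scope ring_scope.

Record fps (R : Type) := Fps { fps_coef :> nat -> R }.
Arguments Fps {R}.

HB.instance Definition _ (R : Type) := gen_eqMixin (fps R).
HB.instance Definition _ (R : Type) := gen_choiceMixin (fps R).

Lemma fpsP (R : Type) (f g : fps R) : (forall n, f n = g n) <-> f = g.
Proof.
split=> [|->//]; case: f => f; case: g => g /= fg; congr Fps; exact: funext.
Qed.

Section FpsRing.
Variable R : comNzRingType.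
Implicit Types f g h : fps R.

Definition fps_zero : fps R := Fps (fun=> 0).
Definition fps_opp f := Fps (fun n => - f n).
Definition fps_add f g := Fps (fun n => f n + g n).
Definition fps_one : fps R := Fps (fun n => (n == 0)%:R).
Definition fps_mul f g := Fps (fun n => \sum_(i < n.+1) f i * g (n - i)%N).

Lemma fps_addA : associative fps_add.
Proof. by move=> f g h; apply/fpsP => n /=; rewrite addrA. Qed.
Lemma fps_addC : commutative fps_add.
Proof. by move=> f g; apply/fpsP => n /=; rewrite addrC. Qed.
Lemma fps_add0 : left_id fps_zero fps_add.
Proof. by move=> f; apply/fpsP => n /=; rewrite add0r. Qed.
Lemma fps_addN : left_inverse fps_zero fps_opp fps_add.
Proof. by move=> f; apply/fpsP => n /=; rewrite addNr. Qed.

HB.instance Definition _ :=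
  GRing.isZmodule.Build (fps R) fps_addA fps_addC fps_add0 fps_addN.

Definition fps_trunc N f : {poly R} := \poly_(i < N) f i.

Lemma fps_mul_trunc N f g n : (n < N)%N ->
  fps_mul f g n = (fps_trunc N f * fps_trunc N g)`_n.
Proof.
move=> nN; rewrite coefM; apply: eq_bigr => i _; rewrite !coef_poly.
rewrite (leq_ltn_trans (leq_subr i n) nN).
by rewrite (leq_trans (ltn_ord i) nN).
Qed.

Lemma fps_mulC : commutative fps_mul.
Proof.
by move=> f g; apply/fpsP => n; rewrite !(@fps_mul_trunc n.+1) // mulrC.
Qed.

Lemma fps_mulA : associative fps_mul.
Proof.
move=> f g h; apply/fpsP => n.
transitivity (fps_trunc n.+1 f * (fps_trunc n.+1 g * fps_trunc n.+1 h))`_n.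
  rewrite coefM; apply: eq_bigr => i _; rewrite coef_poly ltn_ord.
  by rewrite -fps_mul_trunc // ltnS leq_subr.
rewrite mulrA coefM; apply: eq_bigr => i _.
by rewrite -fps_mul_trunc ?coef_poly ?ltnS ?leq_subr // -ltnS.
Qed.

Lemma fps_mul1 : left_id fps_one fps_mul.
Proof.
move=> f; apply/fpsP => n /=; rewrite big_ord_recl subn0 mul1r.
by rewrite big1 ?addr0 // => i _; rewrite mul0r.
Qed.

Lemma fps_mulDl : left_distributive fps_mul fps_add.
Proof.
move=> f g h; apply/fpsP => n /=; rewrite -big_split.
by apply: eq_bigr => i _; rewrite mulrDl.
Qed.

Lemma fps_one_neq0 : fps_one != fps_zero.
Proof. by apply/eqP => /fpsP/(_ 0) /= /eqP; rewrite oner_eq0. Qed.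

HB.instance Definition _ := GRing.Zmodule_isComNzRing.Build (fps R)
  fps_mulA fps_mulC fps_mul1 fps_mulDl fps_one_neq0.

Lemma fps0E n : (0 : fps R) n = 0. Proof. by []. Qed.
Lemma fps1E n : (1 : fps R) n = (n == 0)%:R. Proof. by []. Qed.
Lemma fpsDE f g n : (f + g) n = f n + g n. Proof. by []. Qed.
Lemma fpsNE f n : (- f) n = - f n. Proof. by []. Qed.
Lemma fpsBE f g n : (f - g) n = f n - g n. Proof. by []. Qed.
Lemma fpsME f g n : (f * g) n = \sum_(i < n.+1) f i * g (n - i)%N.
Proof. by []. Qed.
Lemma fps_natE k n : (k%:R : fps R) n = k%:R *+ (n == 0).
Proof.
elim: k => [|k IH]; first by rewrite fps0E mul0rn.
by rewrite -natr1 fpsDE IH fps1E -natr1 mulrnDl.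
Qed.
Lemma fps_sumE (I : Type) (r : seq I) (P : pred I) (F : I -> fps R) n :
  (\sum_(i <- r | P i) F i) n = \sum_(i <- r | P i) F i n.
Proof. exact: (big_morph (fun f : fps R => f n)). Qed.

Lemma fps_expE_lt f k n : f 0 = 0 -> (n < k)%N -> (f ^+ k) n = 0.
Proof.
move=> f0; elim: k n => // k IH n nk; rewrite exprS fpsME big1 // => -[i /=].
rewrite ltnS => le_in _; case: i le_in => [|i] le_in; first by rewrite f0 mul0r.
by rewrite IH ?mulr0 // -subSn // subSS (leq_trans (leq_subr _ _)).
Qed.

Definition fpsX : fps R := Fps (fun n => (n == 1)%:R).

Lemma fpsXM f n : (fpsX * f) n = if n is m.+1 then f m else 0.
Proof.
rewrite fpsME; case: n => [|n]; first by rewrite big_ord1 mul0r.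
rewrite !big_ord_recl /= mul0r add0r mul1r subSS subn0.
by rewrite big1 ?addr0 // => i _; rewrite mul0r.
Qed.

Lemma fpsXI : injective ( *%R fpsX ).
Proof.
by move=> f g /fpsP fg; apply/fpsP => n; move: (fg n.+1); rewrite !fpsXM.
Qed.

End FpsRing.

Notation "''t'" := (fpsX _) (at level 0) : ring_scope.

Section FpsUnitRing.
Variable R : comUnitRingType.
Implicit Types f g h q u : fps R.

Definition fps_unit : pred (fps R) := fun f => f 0 \is a GRing.unit.

(* With c = f 0 and w = 1 - f / c, this is c^-1 * \sum_k w ^+ k; w has no
   constant term, so the terms with k > n do not contribute to 't^n. *)
Definition fps_inv f : fps R :=
  if fps_unit f then
    Fps (fun n => (f 0)^-1 *
      \sum_(k < n.+1) ((1 - Fps (fun m => f m / f 0)) ^+ k) n)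
  else f.

Lemma fps_mulVx : {in fps_unit, left_inverse 1 fps_inv *%R}.
Proof.
move=> f uf; have {}uf : fps_unit f by []; rewrite /fps_inv uf.
set c := f 0; set g := Fps (fun m => f m / c); set w := 1 - g.
have w0 : w 0 = 0 by rewrite fpsBE fps1E /= divrr ?subrr.
apply/fpsP => n; rewrite fpsME.
have geom : (\sum_(k < n.+1) w ^+ k) * g = 1 - w ^+ n.+1.
  by rewrite -opprB subrX1 -mulNr opprB /w subKr mulrC.
transitivity (((\sum_(k < n.+1) w ^+ k) * g) n); last first.
  by rewrite geom fpsBE fps_expE_lt // subr0.
rewrite fpsME; apply: eq_bigr => -[i /= lein] _.
rewrite -mulrA mulrC -mulrA; congr (_ * _).
rewrite fps_sumE (big_ord_widen n.+1 (fun k => (w ^+ k) i)) //.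
rewrite [in RHS](bigID (fun k : 'I_n.+1 => (k < i.+1)%N)) /=.
rewrite [X in _ + X]big1 ?addr0 // => k; rewrite -leqNgt => ik.
exact: fps_expE_lt.
Qed.

Lemma fps_unitPl f g : g * f = 1 -> fps_unit f.
Proof.
move=> /fpsP/(_ 0); rewrite fpsME big_ord1 subnn => gf1.
by apply/unitrPr; exists (g 0); rewrite mulrC.
Qed.

Lemma fps_inv_out : {in [predC fps_unit], fps_inv =1 id}.
Proof.
move=> f nuf; have {}nuf : ~~ fps_unit f by [].
by rewrite /fps_inv (negbTE nuf).
Qed.

HB.instance Definition _ := GRing.ComNzRing_hasMulInverse.Build (fps R)
  fps_mulVx fps_unitPl fps_inv_out.

Lemma fps_unitE f : (f \is a GRing.unit) = (f 0 \is a GRing.unit).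
Proof. by []. Qed.

(* The quotient f / g of two series with g dividing f; the ring operation
   f * g^-1 is meaningless when g has zero constant term. *)
Definition fps_div f g : fps R := xget 0 [set q | q * g = f].

Lemma fps_divXE f u : u \is a GRing.unit -> fps_div ('t * f) ('t * u) = f / u.
Proof.
move=> uu; apply: xget_unique => /= [|q]; first by rewrite mulrCA divrK.
by rewrite mulrCA => /fpsXI <-; rewrite mulrK.
Qed.

(* e^{a t}; here and below, divisions by naturals are meaningful when positive
   naturals are units of R, as in rat and {poly rat}. *)
Definition fps_exp (a : R) : fps R := Fps (fun n => a ^+ n / n`!%:R).

(* log(1 + t) *)
Definition fps_log1p : fps R :=
  Fps (fun n => if n is m.+1 then (-1) ^+ m / n%:R else 0).

(* (1 + t)^a as Newton's binomial series *)
Definition fps_pow1p (a : R) : fps R :=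
  Fps (fun n => (\prod_(i < n) (a - i%:R)) / n`!%:R).

(* The sequence a such that f = \sum_n a_n t^n / n!. *)
Definition egf_coef f (n : nat) : R := n`!%:R * f n.

End FpsUnitRing.

Arguments fps_log1p {R}.

(* Series in 't over {poly rat}; 'X is the indeterminate x. *)
Definition type2_bernoulli_gf : fps {poly rat} :=
  fps_div 't (fps_exp 1 - fps_exp (-1)) * fps_exp 'X.

Definition type2_daehee_gf : fps {poly rat} :=
  fps_div fps_log1p ((1 + 't) - (1 + 't)^-1) * fps_pow1p 'X.

Definition type2_bernoulli (n : nat) : {poly rat} :=
  egf_coef type2_bernoulli_gf n.
Definition type2_daehee (n : nat) : {poly rat} := egf_coef type2_daehee_gf n.

Definition type2_bernoulli_num (n : nat) : rat := (type2_bernoulli n).[0].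
Definition type2_daehee_num (n : nat) : rat := (type2_daehee n).[0].

Definition stirling1 (n l : nat) : rat :=
  egf_coef (fps_log1p ^+ l / l`!%:R) n.

Lemma natr_unit_polyrat n : n.+1%:R \is a @GRing.unit {poly rat}.
Proof.
by rewrite poly_unitE -polyC_natr size_polyC coefC /= unitfE pnatr_eq0.
Qed.

(* Both quotients exist, so [fps_div] never takes its default value above. *)
Lemma type2_bernoulli_divK :
  fps_div 't (fps_exp 1 - fps_exp (-1)) * (fps_exp 1 - fps_exp (-1))
  = 't :> fps {poly rat}.
Proof.
set g := fps_exp 1 - _; pose u : fps {poly rat} := Fps (fun n => g n.+1).
have gE : g = 't * u.
  by apply/fpsP => -[|n]; rewrite fpsXM // fpsBE /= !expr0 subrr.
have uu : u \is a GRing.unit.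
  rewrite fps_unitE /= !expr1 (_ : 1`! = 1%N) // divr1 mulN1r opprK invr1.
  exact: (natr_unit_polyrat 1).
by rewrite gE -{1}[X in fps_div X]mulr1 fps_divXE // mul1r mulrCA mulVr ?mulr1.
Qed.

Lemma type2_daehee_divK :
  fps_div fps_log1p ((1 + 't) - (1 + 't)^-1) * ((1 + 't) - (1 + 't)^-1)
  = fps_log1p :> fps {poly rat}.
Proof.
set p : fps {poly rat} := 1 + 't.
have up : p \is a GRing.unit by rewrite fps_unitE fpsDE fps1E /= addr0 unitr1.
pose l : fps {poly rat} := Fps (fun n => fps_log1p n.+1).
have lE : fps_log1p = 't * l.
  by apply/fpsP => -[|n]; rewrite fpsXM.
have gE : p - p^-1 = 't * ((2%:R + 't) / p).
  apply: (mulIr up); rewrite mulrBl mulVr // mulrA divrK //.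
  by rewrite /p; ring.
have u2 : (2%:R + 't) / p \is a GRing.unit.
  rewrite unitrMl ?unitrV // fps_unitE fpsDE fps_natE /= addr0.
  exact: (natr_unit_polyrat 1).
by rewrite lE gE fps_divXE // mulrCA divrK.
Qed.

(* Main.v *)
(** The type 2 Daehee generating function is the type 2 Bernoulli generating
    function composed with log(1 + t): composition with a series without
    constant term is a ring morphism and sends e^{at} to (1 + t)^a. The latter
    holds because (1 + t)^a is the only solution of (1 + t) F' = a F with
    constant term 1. The theorem is then read off the coefficients of the
    composite, those of log(1 + t)^l being Stirling numbers. *)
From HB Require Import structures.
Require Import Defs.
From mathcomp Require Import all_boot all_order all_algebra.
From mathcomp Require Import ring.

Set Implicit Arguments.
Unset Strict Implicit.
Unset Printing Implicit Defensive.

Import GRing.Theory.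
Local Open Scope ring_scope.

Section Composition.
Variable R : comNzRingType.
Implicit Types (f g h : fps R) (p q : {poly R}).

Definition fpsC (c : R) : fps R := Fps (fun n => c *+ (n == 0)).

Lemma fpsCM c f n : (fpsC c * f) n = c * f n.
Proof.
rewrite fpsME big_ord_recl /= subn0 big1 ?addr0 // => i _.
by rewrite mulr0n mul0r.
Qed.

Fact fpsC_is_zmod_morphism : zmod_morphism fpsC.
Proof. by move=> a b; apply/fpsP => n; rewrite fpsBE /= mulrnBl. Qed.

Fact fpsC_is_monoid_morphism : monoid_morphism fpsC.
Proof.
by split=> [|a b]; apply/fpsP => n; rewrite ?fpsCM ?fps1E //= mulrnAr.
Qed.

HB.instance Definition _ :=
  GRing.isZmodMorphism.Build R (fps R) fpsC fpsC_is_zmod_morphism.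
HB.instance Definition _ :=
  GRing.isMonoidMorphism.Build R (fps R) fpsC fpsC_is_monoid_morphism.

Lemma coef_map_fpsC p i : (map_poly fpsC p)`_i = fpsC p`_i.
Proof. by rewrite (coef_map fpsC). Qed.

Lemma fpsME_eq f f' g g' n :
  (forall i, (i <= n)%N -> f i = f' i) ->
  (forall i, (i <= n)%N -> g i = g' i) -> (f * g) n = (f' * g') n.
Proof.
move=> ff' gg'; rewrite !fpsME; apply: eq_bigr => i _.
by rewrite ff' ?gg' ?leq_subr // -ltnS.
Qed.

(** A product's coefficient of index [n] sees its factors only up to index [n], so identities of
    series can be imported from polynomials by truncation. *)
Lemma coefM_fps f g p q n :
  (forall i, (i <= n)%N -> p`_i = f i) ->
  (forall i, (i <= n)%N -> q`_i = g i) -> (p * q)`_n = (f * g) n.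
Proof.
move=> pf qg; rewrite coefM fpsME; apply: eq_bigr => i _.
by rewrite pf ?qg ?leq_subr // -ltnS.
Qed.

Lemma coef_fps_trunc N f i : (i < N)%N -> (fps_trunc N f)`_i = f i.
Proof. by move=> iN; rewrite coef_poly iN. Qed.

Definition fps_deriv f : fps R := Fps (fun n => f n.+1 *+ n.+1).

Lemma fps_derivM f g :
  fps_deriv (f * g) = fps_deriv f * g + f * fps_deriv g.
Proof.
apply/fpsP => n; rewrite fpsDE.
(* Truncation must keep index [n.+1], which differentiation shifts down to [n]. *)
pose T := @fps_trunc R n.+2; have TE h i : (i <= n.+1)%N -> (T h)`_i = h i.
  by move=> le_in; rewrite coef_fps_trunc.
rewrite [LHS]/= -[X in X *+ _](coefM_fps (TE f) (TE g)).
rewrite -coef_deriv derivM coefD.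
have TE' h i : (i <= n)%N -> (T h)^`()`_i = fps_deriv h i.
  by move=> le_in; rewrite coef_deriv TE.
by congr (_ + _); apply: coefM_fps => i le_in; rewrite ?TE' ?TE // leqW.
Qed.

Lemma fps_derivXn f k :
  fps_deriv (f ^+ k.+1) = f ^+ k * fps_deriv f *+ k.+1.
Proof.
elim: k => [|k IH]; first by rewrite expr1 mul1r.
by rewrite exprS fps_derivM IH mulrnAr mulrA -exprS mulrC -mulrS.
Qed.

Lemma fps_mulrnE f k n : (f *+ k) n = f n *+ k.
Proof. by elim: k => // k IH; rewrite !mulrS fpsDE IH. Qed.

(* The substitution f(g(t)), meaningful only when g has no constant term. *)
Definition fps_comp f g : fps R :=
  Fps (fun n => \sum_(k < n.+1) f k * (g ^+ k) n).

Lemma fps_compE f g n : fps_comp f g n = \sum_(k < n.+1) f k * (g ^+ k) n.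
Proof. by []. Qed.

Lemma fps_compZ a f g : fps_comp (fpsC a * f) g = fpsC a * fps_comp f g.
Proof.
apply/fpsP => n; rewrite fpsCM !fps_compE mulr_sumr.
by apply: eq_bigr => i _; rewrite fpsCM mulrA.
Qed.

Variable g : fps R.
Hypothesis g0 : g 0 = 0.

(** Powers of [g] beyond the [n]-th vanish at index [n], so the higher coefficients of [p] are
    harmless. Algebraic laws of composition thus reduce to those of [horner]. *)
Lemma fps_comp_poly f p n : (forall i, (i <= n)%N -> p`_i = f i) ->
  fps_comp f g n = (map_poly fpsC p).[g] n.
Proof.
(* A common range on which both sums can be compared. *)
move=> pf; set N := maxn n.+1 (size p).
have sN : (size (map_poly fpsC p) <= N)%N.
  by rewrite (leq_trans (size_poly _ _)) ?leq_maxr.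
rewrite (horner_coef_wide _ sN) fps_sumE fps_compE.
rewrite (big_ord_widen N (fun k => f k * (g ^+ k) n)) ?leq_maxl //.
rewrite [RHS](bigID (fun k : 'I_N => (k < n.+1)%N)).
rewrite [X in _ = _ + X]big1 ?addr0 => [|k /andP[_ nk]]; last first.
  have {}nk : (n < k)%N by rewrite ltnNge.
  by rewrite coef_map_fpsC fpsCM fps_expE_lt ?mulr0.
by apply: eq_bigr => k kn; rewrite coef_map_fpsC fpsCM pf.
Qed.

Lemma fps_compM f h : fps_comp (f * h) g = fps_comp f g * fps_comp h g.
Proof.
apply/fpsP => n; pose T := @fps_trunc R n.+1.
have TE e i : (i <= n)%N -> (T e)`_i = e i.
  by move=> le_in; rewrite coef_fps_trunc.
have compT e i : (i <= n)%N -> fps_comp e g i = (map_poly fpsC (T e)).[g] i.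
  by move=> le_in; apply: fps_comp_poly => j ji; rewrite TE // (leq_trans ji).
rewrite (fps_comp_poly (p := T f * T h)) => [|i le_in].
  by rewrite rmorphM hornerM; apply: fpsME_eq => i le_in; rewrite compT.
by apply: coefM_fps => j ji; rewrite TE // (leq_trans ji).
Qed.

Lemma fps_compB f h : fps_comp (f - h) g = fps_comp f g - fps_comp h g.
Proof.
apply/fpsP => n; rewrite fpsBE /= -sumrB.
by apply: eq_bigr => i _; rewrite mulrBl.
Qed.

Lemma fps_compX : fps_comp 't g = g.
Proof.
apply/fpsP => n; rewrite (fps_comp_poly (p := 'X)) => [|i _].
  by rewrite map_polyX hornerX.
by rewrite coefX.
Qed.

Lemma fps_deriv_comp f :
  fps_deriv (fps_comp f g) = fps_comp (fps_deriv f) g * fps_deriv g.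
Proof.
apply/fpsP => n; pose p := \poly_(i < n.+1) fps_deriv f i.
(* With the left factor now a finite sum of powers of [g], the chain rule follows term by term from
   the power rule. *)
rewrite (@fpsME_eq _ (map_poly fpsC p).[g] _ (fps_deriv g)) => [|i le_in|//].
  have sp : (size (map_poly fpsC p) <= n.+1)%N.
    by rewrite (leq_trans (size_poly _ _)) ?size_poly.
  rewrite (horner_coef_wide _ sp) mulr_suml fps_sumE [LHS]/= -sumrMnl.
  (* The term of exponent 0 is constant and its derivative vanishes; the others are shifted by
     one. *)
  rewrite big_ord_recl fps1E mulr0 mul0rn add0r; apply: eq_bigr => i _.
  rewrite coef_map_fpsC coef_poly ltn_ord -mulrA fpsCM lift0 -mulrnAr.
  have /fpsP/(_ n)/= -> := fps_derivXn g i.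
  by rewrite fps_mulrnE mulrnAr -mulrnAl.
by apply: fps_comp_poly => j ji; rewrite coef_poly ltnS (leq_trans ji).
Qed.

End Composition.

Section ExpLog.
Variable R : comUnitRingType.
Hypothesis natS_unit : forall n, n.+1%:R \is a @GRing.unit R.
Implicit Types (a : R) (f : fps R).

Let fact_unit n : n`!%:R \is a @GRing.unit R.
Proof. by case: n`! (fact_gt0 n) => // m _. Qed.

(** The differential equation amounts to a first-order recurrence on coefficients, which the
    binomial coefficients of [a] satisfy. *)
Lemma fps_pow1p_unique a f :
  f 0 = 1 -> (1 + 't) * fps_deriv f = fpsC a * f -> f = fps_pow1p a.
Proof.
move=> f0 eqf.
have rec n : f n.+1 * n.+1%:R = (a - n%:R) * f n.
  have /fpsP/(_ n) := eqf; rewrite mulrDl mul1r fpsDE fpsXM fpsCM /= => eqn.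
  rewrite mulrBl -eqn mulr_natr; case: n {eqn} => [|n] /=.
    by rewrite mul0r addr0 subr0.
  by rewrite mulr_natl addrK.
apply/fpsP; elim=> [|n IH] /=; first by rewrite big_ord0 f0 divr1.
apply: (mulIr (natS_unit n)); rewrite rec IH big_ord_recr /= factS natrM.
by rewrite invrM // [in RHS]mulrA divrK // mulrCA mulrA.
Qed.

Lemma fps_deriv_add1X : fps_deriv (1 + 't) = 1 :> fps R.
Proof.
by apply/fpsP => -[|n]; rewrite /= add0r // mul0rn.
Qed.

Lemma fps_pow1p1 : fps_pow1p 1 = 1 + 't :> fps R.
Proof.
apply/esym/fps_pow1p_unique; first by rewrite fpsDE /= addr0.
rewrite rmorph1 mul1r -[RHS]mulr1; congr (_ * _).
exact: fps_deriv_add1X.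
Qed.

Lemma fps_add1X_unit : 1 + 't \is a @GRing.unit (fps R).
Proof. by rewrite fps_unitE fpsDE /= addr0 unitr1. Qed.

Lemma fps_pow1pN1 : fps_pow1p (-1) = (1 + 't)^-1 :> fps R.
Proof.
have inv := mulrV fps_add1X_unit.
apply/esym/fps_pow1p_unique.
  have /fpsP/(_ 0) := inv.
  by rewrite fpsME big_ord1 subnn fpsDE /= addr0 mul1r.
(* Differentiating the constant product of [1 + 't] and its inverse yields the equation for the
   inverse. *)
have : fps_deriv ((1 + 't) / (1 + 't) : fps R) = 0.
  by rewrite inv; apply/fpsP => n; rewrite /= mul0rn.
rewrite fps_derivM => /eqP; rewrite addrC addr_eq0 => /eqP ->.
by rewrite rmorphN rmorph1 mulNr fps_deriv_add1X mul1r.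
Qed.

Lemma fps_deriv_log1p : (1 + 't) * fps_deriv fps_log1p = 1 :> fps R.
Proof.
apply/fpsP => n; rewrite mulrDl mul1r fpsDE fpsXM fps1E /=.
rewrite -[_ *+ _]mulr_natr divrK //.
case: n => [|n] /=; first by rewrite addr0.
by rewrite -[_ *+ n.+1]mulr_natr divrK // exprS mulN1r addNr.
Qed.

Lemma fps_deriv_exp a : fps_deriv (fps_exp a) = fpsC a * fps_exp a.
Proof.
apply/fpsP => n; rewrite fpsCM /= factS natrM invrM // exprS.
by rewrite -[_ *+ _]mulr_natr mulrA divrK // mulrA.
Qed.

Lemma fps_comp_exp_log1p a : fps_comp (fps_exp a) fps_log1p = fps_pow1p a.
Proof.
apply: fps_pow1p_unique.
  by rewrite /= big_ord1 !expr0 fps1E mulr1 divr1.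
rewrite fps_deriv_comp // mulrCA fps_deriv_log1p mulr1 fps_deriv_exp.
exact: fps_compZ.
Qed.

End ExpLog.

Lemma type2_daehee_gf_comp :
  type2_daehee_gf = fps_comp type2_bernoulli_gf fps_log1p.
Proof.
rewrite /type2_daehee_gf /type2_bernoulli_gf fps_compM //.
rewrite (fps_comp_exp_log1p natr_unit_polyrat); congr (_ * _).
set B := fps_div 't _; set D := fps_div _ _.
(* Both sides equal log(1 + t): the left by definition of [D], the right by substituting log(1 + t)
   into the identity that defines [B]. *)
have eqDB : D * ((1 + 't) - (1 + 't)^-1)
          = fps_comp B fps_log1p * ((1 + 't) - (1 + 't)^-1).
  rewrite type2_daehee_divK -[LHS]fps_compX //.
  rewrite -[X in fps_comp X]type2_bernoulli_divK.
  rewrite fps_compM // fps_compB !(fps_comp_exp_log1p natr_unit_polyrat).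
  by rewrite (fps_pow1p1 natr_unit_polyrat) (fps_pow1pN1 natr_unit_polyrat).
have u1 := fps_add1X_unit {poly rat}.
have u2 : 2%:R + 't \is a @GRing.unit (fps {poly rat}).
  rewrite fps_unitE fpsDE fps_natE /= addr0.
  exact: (natr_unit_polyrat 1).
(* The common factor in [eqDB] has no constant term, hence is not a unit; this factorization still
   lets it be cancelled, as ['t] is regular and 2 + t invertible. *)
have gE : ((1 + 't) - (1 + 't)^-1) * (1 + 't) = 't * (2%:R + 't)
            :> fps {poly rat}.
  by rewrite mulrBl mulVr //; ring.
apply/(mulIr u2)/fpsXI; rewrite !(mulrCA 't) -gE !mulrA.
by rewrite eqDB.
Qed.

(** Needed because Stirling numbers are read off series over [rat], the generating functions off
    series over [{poly rat}]. *)
Lemma fps_log1pXn_polyC k n :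
  ((fps_log1p : fps {poly rat}) ^+ k) n = ((fps_log1p ^+ k : fps rat) n)%:P.
Proof.
elim: k n => [|k IH] n; first by rewrite !fps1E polyC_natr.
rewrite !exprS !fpsME rmorph_sum; apply: eq_bigr => -[i /= _] _.
rewrite IH polyCM; congr (_ * _); case: i => // i /=.
rewrite polyCM rmorphXn rmorphN rmorph1 rmorphV ?unitfE ?Num.Theory.pnatr_eq0 //.
by rewrite rmorph_nat.
Qed.

Lemma stirling1E n l :
  stirling1 n l * l`!%:R = n`!%:R * (fps_log1p ^+ l : fps rat) n.
Proof.
have ul : l`!%:R \is a @GRing.unit (fps rat).
  by rewrite fps_unitE fps_natE unitfE Num.Theory.pnatr_eq0 -lt0n fact_gt0.
rewrite /stirling1 /egf_coef -mulrA; congr (_ * _).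
by rewrite mulr_natr -fps_mulrnE -[(_ / _) *+ _]mulr_natr divrK.
Qed.

Theorem theorem5 (n : nat) :
  type2_daehee n = \sum_(0 <= l < n.+1) stirling1 n l *: type2_bernoulli l
  /\ type2_daehee_num n
     = \sum_(0 <= l < n.+1) stirling1 n l * type2_bernoulli_num l.
Proof.
have dE :
    type2_daehee n = \sum_(0 <= l < n.+1) stirling1 n l *: type2_bernoulli l.
  rewrite big_mkord /type2_daehee /egf_coef type2_daehee_gf_comp /= mulr_sumr.
  apply: eq_bigr => l _; rewrite fps_log1pXn_polyC mulrCA mulrC.
  (* The factorial of [l] released by [stirling1E] turns the coefficient of index [l] of the
     Bernoulli series into [type2_bernoulli l]. *)
  rewrite -[n`!%:R]polyC_natr -polyCM -stirling1E polyCM polyC_natr -mulrA.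
  by rewrite mul_polyC.
split=> //; rewrite /type2_daehee_num dE horner_sum.
by apply: eq_bigr => l _; rewrite hornerZ.
Qed.
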